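(* Suppose the angles in a spherical tiling by $12$ angle congruent pentagons are $\alpha,\beta,\gamma,\delta,\epsilon$, with $\alpha=\frac{2\pi}{3}$ and all five angles distinct. Then, up to symmetry, the tiling must have anglewise vertex combination $\{2\alpha^3,6\alpha\gamma\epsilon,6\beta^2\gamma,6\delta^2\epsilon\}$ and is given by one of the following four tilings (angle words on the dodecahedral pattern, as explained in the context). (i) $P_1:\alpha\beta\epsilon\delta\gamma$; $P_2:\alpha\beta\epsilon\delta\gamma$; $P_3:\epsilon\delta\gamma\alpha\beta$; $P_4:\gamma\alpha\beta\epsilon\delta$; $P_5:\delta\gamma\alpha\beta\epsilon$; $P_6:\delta\gamma\alpha\beta\epsilon$; $P_7:\alpha\beta\epsilon\delta\gamma$; $P_8:\delta\gamma\alpha\beta\epsilon$; $P_9:\delta\gamma\alpha\beta\epsilon$; $P_{10}:\gamma\alpha\beta\epsilon\delta$; $P_{11}:\epsilon\delta\gamma\alpha\beta$; $P_{12}:\alpha\beta\epsilon\delta\gamma$. (ii) $P_1:\alpha\beta\delta\epsilon\gamma$; $P_2:\alpha\beta\delta\epsilon\gamma$; $P_3:\epsilon\delta\beta\alpha\gamma$; $P_4:\beta\alpha\gamma\epsilon\delta$; $P_5:\epsilon\gamma\alpha\beta\delta$; $P_6:\delta\beta\alpha\gamma\epsilon$; $P_7:\alpha\beta\delta\epsilon\gamma$; $P_8:\delta\beta\alpha\gamma\epsilon$; $P_9:\epsilon\gamma\alpha\beta\delta$; $P_{10}:\beta\alpha\gamma\epsilon\delta$; $P_{11}:\epsilon\delta\beta\alpha\gamma$;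 $P_{12}:\alpha\beta\delta\epsilon\gamma$. (iii) $P_1:\alpha\gamma\beta\delta\epsilon$; $P_2:\delta\beta\gamma\alpha\epsilon$; $P_3:\gamma\alpha\epsilon\delta\beta$; $P_4:\beta\delta\epsilon\alpha\gamma$; $P_5:\beta\gamma\alpha\epsilon\delta$; $P_6:\epsilon\alpha\gamma\beta\delta$; $P_7:\beta\gamma\alpha\epsilon\delta$; $P_8:\beta\delta\epsilon\alpha\gamma$; $P_9:\gamma\alpha\epsilon\delta\beta$; $P_{10}:\delta\beta\gamma\alpha\epsilon$; $P_{11}:\epsilon\alpha\gamma\beta\delta$; $P_{12}:\delta\epsilon\alpha\gamma\beta$. (iv) $P_1:\alpha\epsilon\beta\delta\gamma$; $P_2:\beta\delta\gamma\alpha\epsilon$; $P_3:\gamma\alpha\epsilon\beta\delta$; $P_4:\delta\beta\epsilon\alpha\gamma$; $P_5:\beta\epsilon\alpha\gamma\delta$; $P_6:\epsilon\alpha\gamma\delta\beta$; $P_7:\delta\gamma\alpha\epsilon\beta$; $P_8:\beta\delta\gamma\alpha\epsilon$; $P_9:\epsilon\alpha\gamma\delta\beta$; $P_{10}:\delta\beta\epsilon\alpha\gamma$; $P_{11}:\gamma\alpha\epsilon\beta\delta$; $P_{12}:\beta\epsilon\alpha\gamma\delta$.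
   Context: A spherical tiling by $12$ pentagons (graph embedded in $S^2$ with all vertices of degree $\ge 3$, every tile a five-edged region enclosed by a simple closed curve; edges may be any nice curves) is combinatorially the dodecahedral pattern: tiles $P_1,\dots,P_{12}$, where $P_i$ with list $(n_1,\dots,n_5)$ has edges in counterclockwise order $E_{i,n_1},\dots,E_{i,n_5}$, $E_{i,j}=E_{j,i}$ being the common edge of $P_i$ and $P_j$, and (with $n_6=n_1$) $E_{i,n_k},E_{i,n_{k+1}}$ meet at the vertex $V_{i,n_k,n_{k+1}}$ of degree $3$ shared by $P_i,P_{n_k},P_{n_{k+1}}$: $P_1:(2,3,4,5,6)$; $P_2:(1,6,11,7,3)$; $P_3:(1,2,7,8,4)$; $P_4:(1,3,8,9,5)$; $P_5:(1,4,9,10,6)$; $P_6:(1,5,10,11,2)$; $P_7:(12,8,3,2,11)$; $P_8:(12,9,4,3,7)$; $P_9:(12,10,5,4,8)$; $P_{10}:(12,11,6,5,9)$; $P_{11}:(12,7,2,6,10)$; $P_{12}:(7,11,10,9,8)$. ''$P_i:w_1w_2w_3w_4w_5$'' means that the angle of $P_i$ at $V_{i,n_k,n_{k+1}}$ is $w_k$ for $k=1,\dots,5$. An angle congruent tiling is considered as an assignment of angles to all (tile, vertex) corners such that the angles at every vertex sum to $2\pi$ and any two tiles are angle congruent, i.e. there is an adjacency-preserving correspondence of their edges that preserves the angles between adjacent edges (reflections allowed). No geometric realization by great arcs is required. The anglewise vertex combination lists all vertices by the multiset of angles at them, with multiplicity: $\{2\alpha^3,6\alpha\gamma\epsilon,6\beta^2\gamma,6\delta^2\epsilon\}$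 means that there are exactly $2$ vertices with angles $\alpha,\alpha,\alpha$, $6$ with angles $\alpha,\gamma,\epsilon$, $6$ with angles $\beta,\beta,\gamma$, $6$ with angles $\delta,\delta,\epsilon$, and no others. ''Up to symmetry'' means up to symmetries of the dodecahedral pattern (including reflections) and up to renaming $\beta,\gamma,\delta,\epsilon$. *)

(* Defs.v *)
From mathcomp Require Import all_boot all_order all_algebra.
From mathcomp Require Import perm reals trigo.
Set Implicit Arguments.
Unset Strict Implicit.
Unset Printing Implicit Defensive.
Import Order.TTheory GRing.Theory Num.Theory.
Local Open Scope ring_scope.

(* Tiles are numbered from 1 to 12 in the tables below; P_n is the ordinal
   of value n - 1. *)
Definition tile := 'I_12.
Definition P (n : nat) : tile := inord n.-1.

(* Row i lists the tiles n_1, ..., n_5 adjacent to P_i, in counterclockwise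
   order of the common edges. *)
Definition pattern : seq (seq nat) :=
  [:: [:: 2; 3; 4; 5; 6];
      [:: 1; 6; 11; 7; 3];
      [:: 1; 2; 7; 8; 4];
      [:: 1; 3; 8; 9; 5];
      [:: 1; 4; 9; 10; 6];
      [:: 1; 5; 10; 11; 2];
      [:: 12; 8; 3; 2; 11];
      [:: 12; 9; 4; 3; 7];
      [:: 12; 10; 5; 4; 8];
      [:: 12; 11; 6; 5; 9];
      [:: 12; 7; 2; 6; 10];
      [:: 7; 11; 10; 9; 8]]%N.

Definition nbr (i : tile) (k : 'I_5) : tile :=
  P (nth 0%N (nth [::] pattern i) k).

(* An edge or a vertex is represented by the set of the tiles sharing it:
   E_{i,j} is [set i; j] and V_{i,j,l} is [set i; j; l].  The k-th vertex of
   tile i joins its k-th edge to the next one (ordS is the cyclic successor). *)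
Definition edge (i : tile) (k : 'I_5) : {set tile} := [set i; nbr i k].
Definition vertex (i : tile) (k : 'I_5) : {set tile} :=
  [set i; nbr i k; nbr i (ordS k)].

Definition edges : {set {set tile}} := [set edge i k | i : tile, k : 'I_5].
Definition vertices : {set {set tile}} := [set vertex i k | i : tile, k : 'I_5].

Definition adjacent_edges (k l : 'I_5) : bool := (l == ordS k) || (k == ordS l).

(* For adjacent edges k and l of tile i, [set i; nbr i k; nbr i l] is the vertex
   at which they meet. *)
Definition corner (i : tile) (k l : 'I_5) : {set tile} :=
  [set i; nbr i k; nbr i l].

(* Symmetries of the dodecahedral pattern, reflections included, as
   permutations of the tiles. *)
Definition symmetry (s : {perm tile}) : Prop :=
  (forall e : {set tile}, (s @: e \in edges) = (e \in edges)) /\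
  (forall v : {set tile}, (s @: v \in vertices) = (v \in vertices)).

Section Angles.
Variable R : realType.

(* a i v is the angle of tile i at the vertex v; only the values with
   v \in vertices and i \in v are ever used. *)
Definition angle_assignment := tile -> {set tile} -> R.

Definition angle_congruent (a : angle_assignment) (i j : tile) : Prop :=
  exists f : {perm 'I_5}, forall k l : 'I_5, adjacent_edges k l ->
    adjacent_edges (f k) (f l) /\
    a i (corner i k l) = a j (corner j (f k) (f l)).

Definition angle_congruent_tiling (a : angle_assignment) : Prop :=
  (forall v, v \in vertices -> \sum_(i in v) a i v = 2 * pi) /\
  (forall i j, angle_congruent a i j).

Definition tile_angles (a : angle_assignment) (i : tile) : seq R :=
  [seq a i (vertex i k) | k <- enum 'I_5].

Definition vertex_angles (a : angle_assignment) (v : {set tile}) : seq R :=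
  [seq a i v | i <- enum v].

(* L lists pairs (m, t): exactly m vertices have the multiset t of angles; every
   vertex is accounted for. *)
Definition anglewise_vertex_combination
    (a : angle_assignment) (L : seq (nat * seq R)) : Prop :=
  (forall p, p \in L ->
     #|[set v in vertices | perm_eq (vertex_angles a v) p.2]| = p.1) /\
  (forall v, v \in vertices ->
     exists2 p, p \in L & perm_eq (vertex_angles a v) p.2).

(* Row i of W is the word w_1 ... w_5 of P_i, with w_k the angle of P_i at
   V_{i,n_k,n_{k+1}}; s carries the pattern described by W to the tiling a. *)
Definition given_by
    (a : angle_assignment) (s : {perm tile}) (W : seq (seq R)) : Prop :=
  forall (i : tile) (k : 'I_5),
    a (s i) (s @: vertex i k) = nth 0 (nth [::] W i) k.

Section Words.
Variables al be ga de ep : R.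

Definition tiling_i : seq (seq R) :=
  [:: [:: al; be; ep; de; ga];
      [:: al; be; ep; de; ga];
      [:: ep; de; ga; al; be];
      [:: ga; al; be; ep; de];
      [:: de; ga; al; be; ep];
      [:: de; ga; al; be; ep];
      [:: al; be; ep; de; ga];
      [:: de; ga; al; be; ep];
      [:: de; ga; al; be; ep];
      [:: ga; al; be; ep; de];
      [:: ep; de; ga; al; be];
      [:: al; be; ep; de; ga]].

Definition tiling_ii : seq (seq R) :=
  [:: [:: al; be; de; ep; ga];
      [:: al; be; de; ep; ga];
      [:: ep; de; be; al; ga];
      [:: be; al; ga; ep; de];
      [:: ep; ga; al; be; de];
      [:: de; be; al; ga; ep];
      [:: al; be; de; ep; ga];
      [:: de; be; al; ga; ep];
      [:: ep; ga; al; be; de];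
      [:: be; al; ga; ep; de];
      [:: ep; de; be; al; ga];
      [:: al; be; de; ep; ga]].

Definition tiling_iii : seq (seq R) :=
  [:: [:: al; ga; be; de; ep];
      [:: de; be; ga; al; ep];
      [:: ga; al; ep; de; be];
      [:: be; de; ep; al; ga];
      [:: be; ga; al; ep; de];
      [:: ep; al; ga; be; de];
      [:: be; ga; al; ep; de];
      [:: be; de; ep; al; ga];
      [:: ga; al; ep; de; be];
      [:: de; be; ga; al; ep];
      [:: ep; al; ga; be; de];
      [:: de; ep; al; ga; be]].

Definition tiling_iv : seq (seq R) :=
  [:: [:: al; ep; be; de; ga];
      [:: be; de; ga; al; ep];
      [:: ga; al; ep; be; de];
      [:: de; be; ep; al; ga];
      [:: be; ep; al; ga; de];
      [:: ep; al; ga; de; be];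
      [:: de; ga; al; ep; be];
      [:: be; de; ga; al; ep];
      [:: ep; al; ga; de; be];
      [:: de; be; ep; al; ga];
      [:: ga; al; ep; be; de];
      [:: be; ep; al; ga; de]].

End Words.
End Angles.

(* Main.v *)
Require Import Defs.
From mathcomp Require Import all_boot all_order all_algebra.
From mathcomp Require Import perm reals trigo.
From mathcomp Require Import ring lra.
Import Order.TTheory GRing.Theory Num.Theory.
Local Open Scope ring_scope.
Set Implicit Arguments.
Unset Strict Implicit.
Unset Printing Implicit Defensive.

(* Subtract 2pi/3 from all angles.  Counting all corners by vertices and by tiles shows
   that the deviations of the five angles sum to zero, so they are given by a vector x
   in R^3, which each vertex makes orthogonal to some integral vector and which avoids
   the ten planes on which two angles coincide.  As all tiles carry the same cyclic
   word up to reflection, a tiling is the choice of one of ten words on every tile,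
   hence the theorem is a finite search, tile by tile.  A branch is cut as soon as its
   vertices force x into one of the ten planes; two independent vertices determine x
   up to a factor, so that only cross and dot products of integral vectors are needed.
   Each of the surviving configurations is matched with one of the four tilings by one
   of the 120 symmetries of the pattern and a renaming of the angles. *)

(* Under the call-by-value of [vm_compute], [all] and [has] traverse the whole
   list; these two stop early. *)
Fixpoint every {T : Type} (a : pred T) (s : seq T) : bool :=
  if s is x :: s' then if a x then every a s' else false else true.
Fixpoint any {T : Type} (a : pred T) (s : seq T) : bool :=
  if s is x :: s' then if a x then true else any a s' else false.

Lemma everyE (T : Type) (a : pred T) s : every a s = all a s.
Proof. by elim: s => //= x s ->; case: (a x). Qed.
Lemma anyE (T : Type) (a : pred T) s : any a s = has a s.
Proof. by elim: s => //= x s ->; case: (a x). Qed.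

(** * The pattern, its vertices and the dihedral words, in natural numbers *)

(* Numbers start from 0: tile [i] is P_{i+1}, and a corner [(i, k)] is the angle of
   tile [i] at its [k]-th vertex. *)
Definition nb (i k : nat) : nat := (nth 0 (nth [::] pattern i) k).-1.
Definition vx (i k : nat) : seq nat := [:: i; nb i k; nb i (k.+1 %% 5)].
(** The value is 5 when no vertex of tile [i] is [v]. *)
Definition vertex_pos (i : nat) (v : seq nat) : nat :=
  find (fun k => perm_eq (vx i k) v) (iota 0 5).

Definition corners (i k : nat) : seq (nat * nat) :=
  [seq (j, vertex_pos j (vx i k)) | j <- vx i k].
(** Every vertex arises from each of its three tiles; the filter keeps the copy that starts with the
    smallest one. *)
Definition vertex_list : seq (seq (nat * nat)) :=
  Eval vm_compute in
    [seq v <- [seq corners i k | i <- iota 0 12, k <- iota 0 5]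
       | all (leq (head 0 (unzip1 v))) (unzip1 v)]%N.
(* Entry [n] lists the vertices all of whose tiles are at most [n], with equality
   for one of them. *)
Definition completed : seq (seq (seq (nat * nat))) :=
  Eval vm_compute in
    [seq [seq v <- vertex_list | foldr maxn 0 (unzip1 v) == n]%N | n <- iota 0 12].

Definition rotations : seq (seq nat) := Eval vm_compute in
  [seq rot r (iota 0 5) | r <- iota 0 5].
Definition words : seq (seq nat) := Eval vm_compute in
  rotations ++ map rev rotations.

(** * Integral vectors and the search *)

Definition vec (T : Type) : Type := (T * T * T)%type.
Definition vdot {T : comNzRingType} (u v : vec T) : T :=
  let: (u1, u2, u3) := u in let: (v1, v2, v3) := v in
  u1 * v1 + u2 * v2 + u3 * v3.
Definition vcross {T : comNzRingType} (u v : vec T) : vec T :=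
  let: (u1, u2, u3) := u in let: (v1, v2, v3) := v in
  (u2 * v3 - u3 * v2, u3 * v1 - u1 * v3, u1 * v2 - u2 * v1).

(* Deviations from 2pi/3 of the angles of code 0 (that is al), 1, ..., 4, in terms
   of those of code 1, 2, 3: the five deviations sum to zero. *)
Definition dev : seq (vec int) :=
  [:: 0; (1, 0, 0); (0, 1, 0); (0, 0, 1); (-1, -1, -1)].
(* The ten differences of two angles, up to sign. *)
Definition nonzero : seq (vec int) :=
  [:: (1, 0, 0); (0, 1, 0); (0, 0, 1); (-1, -1, -1);
      (1, -1, 0); (1, 0, -1); (0, 1, -1);
      (2, 1, 1); (1, 2, 1); (1, 1, 2)].

Definition config := seq (seq nat).
Definition code (c : config) (x : nat * nat) : nat := nth 0%N (nth [::] c x.1) x.2.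
Definition vdev (c : config) (v : seq (nat * nat)) : vec int :=
  foldr +%R 0 [seq nth 0 dev (code c x) | x <- v].

(* What is known of the vector x of the deviations: [Orth l] says that x is
   orthogonal to l (nothing, if l = 0), [Dir q] that it is proportional to q. *)
Inductive info := Orth of vec int | Dir of vec int.

(** A branch is cut in three cases: the first nonzero condition [l] is proportional to a form of
    [nonzero]; two independent conditions give a direction [q] orthogonal to such a form; a known
    direction is not orthogonal to [l]. A zero cross product with a nonzero [l'] means that [l] adds
    nothing. *)
Definition update (l : vec int) (K : info) : option info :=
  match K with
  | Orth l' =>
      if l' == 0 then
        if l == 0 then Some K
        else if any (fun m => vcross l m == 0) nonzero then None else Some (Orth l)
      else
        let q := vcross l' l in
        if q == 0 then Some K
        else if any (fun m => vdot m q == 0) nonzero then None else Some (Dir q)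
  | Dir q => if vdot l q == 0 then Some K else None
  end.

Fixpoint refine (c : config) (vs : seq (seq (nat * nat))) (K : info) : option info :=
  if vs is v :: vs' then
    if update (vdev c v) K is Some K' then refine c vs' K' else None
  else Some K.

(** A cut branch counts as a success, so the value [true] means that all surviving full
    configurations satisfy [leaf]. *)
Fixpoint search (leaf : config -> bool) (m : nat) (c : config) (K : info) : bool :=
  if m is m'.+1 then
    all (fun w => let c' := rcons c w in
      if refine c' (nth [::] completed (size c)) K is Some K' then search leaf m' c' K'
      else true) words
  else leaf c.

(** * Symmetries of the pattern and matching with the four tilings *)

Definition adj (i j : nat) : bool := (j \in [seq nb i k | k <- iota 0 5]).
(* Completes [p], read as the images of the first tiles, in all ways that preserve
   adjacency of tiles. *)
Fixpoint extensions (m : nat) (p : seq nat) : seq (seq nat) :=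
  if m is m'.+1 then
    flatten [seq extensions m' (rcons p x) | x <- iota 0 12 &
      (x \notin p) && all (fun j => adj (nth 0 p j) x == adj j (size p))%N
                          (iota 0 (size p))]
  else [:: p].
Definition symmetries : seq (seq nat) := Eval vm_compute in extensions 12 [::].

(* The tilings (i)-(iv), with the codes 0, ..., 4 for al, be, ga, de, ep. *)
Definition tilings : seq config :=
  [:: [:: [:: 0; 1; 4; 3; 2]; [:: 0; 1; 4; 3; 2]; [:: 4; 3; 2; 0; 1];
          [:: 2; 0; 1; 4; 3]; [:: 3; 2; 0; 1; 4]; [:: 3; 2; 0; 1; 4];
          [:: 0; 1; 4; 3; 2]; [:: 3; 2; 0; 1; 4]; [:: 3; 2; 0; 1; 4];
          [:: 2; 0; 1; 4; 3]; [:: 4; 3; 2; 0; 1]; [:: 0; 1; 4; 3; 2]];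
      [:: [:: 0; 1; 3; 4; 2]; [:: 0; 1; 3; 4; 2]; [:: 4; 3; 1; 0; 2];
          [:: 1; 0; 2; 4; 3]; [:: 4; 2; 0; 1; 3]; [:: 3; 1; 0; 2; 4];
          [:: 0; 1; 3; 4; 2]; [:: 3; 1; 0; 2; 4]; [:: 4; 2; 0; 1; 3];
          [:: 1; 0; 2; 4; 3]; [:: 4; 3; 1; 0; 2]; [:: 0; 1; 3; 4; 2]];
      [:: [:: 0; 2; 1; 3; 4]; [:: 3; 1; 2; 0; 4]; [:: 2; 0; 4; 3; 1];
          [:: 1; 3; 4; 0; 2]; [:: 1; 2; 0; 4; 3]; [:: 4; 0; 2; 1; 3];
          [:: 1; 2; 0; 4; 3]; [:: 1; 3; 4; 0; 2]; [:: 2; 0; 4; 3; 1];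
          [:: 3; 1; 2; 0; 4]; [:: 4; 0; 2; 1; 3]; [:: 3; 4; 0; 2; 1]];
      [:: [:: 0; 4; 1; 3; 2]; [:: 1; 3; 2; 0; 4]; [:: 2; 0; 4; 1; 3];
          [:: 3; 1; 4; 0; 2]; [:: 1; 4; 0; 2; 3]; [:: 4; 0; 2; 3; 1];
          [:: 3; 2; 0; 4; 1]; [:: 1; 3; 2; 0; 4]; [:: 4; 0; 2; 3; 1];
          [:: 3; 1; 4; 0; 2]; [:: 2; 0; 4; 1; 3]; [:: 1; 4; 0; 2; 3]]]%N.

Definition image_corner (p : seq nat) (x : nat * nat) : nat * nat :=
  let j := nth 0%N p x.1 in (j, vertex_pos j [seq nth 0 p l | l <- vx x.1 x.2]%N).
Definition all_corners : seq (nat * nat) := Eval vm_compute in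
  [seq (i, k) | i <- iota 0 12, k <- iota 0 5]%N.
(* The letters of [c] at the places that [p] assigns to the letters 0, ..., 4 of the
   first tile of [W]. *)
Definition renaming (c W : config) (p : seq nat) : seq nat :=
  [seq code c (image_corner p (0%N, index z (nth [::] W 0))) | z <- iota 0 5]%N.
(** The letter 0 stands for the special angle [al], so a renaming has to fix it. *)
Definition same_pattern (c W : config) (p : seq nat) : bool :=
  let r := renaming c W p in
  if head 1%N r == 0%N then
    every (fun x => code c (image_corner p x) == nth 0%N r (code W x)) all_corners
  else false.

Definition combination (r : seq nat) : seq (nat * seq nat) :=
  let z := nth 0%N r in
  [:: (2, [:: 0; 0; 0]); (6, [:: 0; z 2; z 4]); (6, [:: z 1; z 1; z 2]);
      (6, [:: z 3; z 3; z 4])]%N.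
Definition has_combination (c : config) (r : seq nat) : bool :=
  let vs := [seq map (code c) v | v <- vertex_list] in
  all (fun mt => count (perm_eq mt.2) vs == mt.1) (combination r) &&
  all (fun v => has (fun mt => perm_eq mt.2 v) (combination r)) vs.

Definition classified (c : config) : bool :=
  any (fun W => any (fun p =>
    if same_pattern c W p then
      perm_eq (renaming c W p) (iota 0 5) && has_combination c (renaming c W p)
    else false) symmetries) tilings.

(** * From numerical tables to sets of tiles *)

Lemma mem_all_corners i k : (i < 12)%N -> (k < 5)%N -> (i, k) \in all_corners.
Proof.
have -> : all_corners = [seq (i, k) | i <- iota 0 12, k <- iota 0 5]%N by [].
by move=> hi hk; apply: allpairs_f; rewrite mem_iota.
Qed.

Lemma nb_lt i k : (i < 12)%N -> (k < 5)%N -> (nb i k < 12)%N.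
Proof.
move=> hi hk; have /allP : all (fun x => nb x.1 x.2 < 12)%N all_corners by vm_compute.
by move/(_ _ (mem_all_corners hi hk)).
Qed.

Definition tset (s : seq nat) : {set tile} := [set j : tile | (j : nat) \in s].

Lemma eq_tset s t : perm_eq s t -> tset s = tset t.
Proof. by move=> /perm_mem st; apply/setP => j; rewrite !inE st. Qed.

Lemma vertexE (i : tile) (k : 'I_5) : vertex i k = tset (vx i k).
Proof.
by apply/setP => j; rewrite !inE -!val_eqE /= !inordK ?orbA // nb_lt // ltn_mod.
Qed.

Lemma edgeE (i : tile) (k : 'I_5) : edge i k = tset [:: i : nat; nb i k].
Proof. by apply/setP => j; rewrite !inE -!val_eqE /= !inordK // nb_lt. Qed.

Lemma vertex_listP v : v \in vertex_list ->
  uniq (unzip1 v) /\ forall x, x \in v ->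
    [/\ (x.1 < 12)%N, (x.2 < 5)%N & perm_eq (vx x.1 x.2) (unzip1 v)].
Proof.
have /allP : all (fun v => uniq (unzip1 v) && all (fun x =>
  [&& x.1 < 12, x.2 < 5 & perm_eq (vx x.1 x.2) (unzip1 v)])%N v) vertex_list.
  by vm_compute.
by move=> h /h /andP[-> /allP hx]; split => // x /hx /and3P[].
Qed.

Lemma vertex_corner v x : v \in vertex_list -> x \in v ->
  vertex (inord x.1) (inord x.2) = tset (unzip1 v).
Proof.
move=> /vertex_listP[_ h] /h[x1 x2 vE]; rewrite vertexE !inordK //; exact: eq_tset.
Qed.

Lemma verticesP A :
  reflect (exists2 v, v \in vertex_list & A = tset (unzip1 v)) (A \in vertices).
Proof.
apply: (iffP imset2P) => [[i k _ _ ->]|[v hv ->]].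
  have /allP/(_ _ (mem_all_corners (ltn_ord i) (ltn_ord k))) : all (fun x =>
    has (fun v => perm_eq (vx x.1 x.2) (unzip1 v)) vertex_list) all_corners by vm_compute.
  by case/hasP => v hv /eq_tset hvx; exists v; rewrite // vertexE.
have [x hx] : exists x, x \in v.
  have /allP/(_ v hv) : all (fun v => 0 < size v)%N vertex_list by vm_compute.
  by case: v {hv} => // x v _; exists x; rewrite mem_head.
by exists (inord x.1) (inord x.2) => //; rewrite (vertex_corner hv hx).
Qed.

Lemma uniq_tset_vertex_list : uniq [seq tset (unzip1 v) | v <- vertex_list].
Proof.
(* Sets of ordinals are told apart by their list of membership bits, which can be computed. *)
pose key (A : {set tile}) := [seq inord j \in A | j <- iota 0 12].
apply: (@map_uniq _ _ key); rewrite -map_comp.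
have /eq_in_map -> : {in vertex_list, key \o (fun v => tset (unzip1 v)) =1
   fun v => [seq j \in unzip1 v | j <- iota 0 12]}.
  move=> v _; apply/eq_in_map => j; rewrite mem_iota => hj; rewrite inE inordK //.
by vm_compute.
Qed.

Lemma card_vertices (Q : pred {set tile}) :
  #|[set A in vertices | Q A]| = count (fun v => Q (tset (unzip1 v))) vertex_list.
Proof.
move: verticesP uniq_tset_vertex_list; move: vertex_list => L LP uniqL.
pose s := [seq A <- [seq tset (unzip1 v) | v <- L] | Q A].
have -> : [set A in vertices | Q A] = [set A in s].
  apply/setP => A; rewrite !inE mem_filter andbC; congr (_ && _).
  by apply/LP/mapP => -[v]; exists v.
by rewrite cardsE (card_uniqP _) ?filter_uniq // size_filter count_map.
Qed.

(** * Angles at corners, and their sums over vertices and tiles *)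

Section CornerAngles.
Variables (R : realType) (a : angle_assignment R).

Definition corner_angle (x : nat * nat) : R :=
  a (inord x.1) (vertex (inord x.1) (inord x.2)).

Lemma perm_vertex_angles v : v \in vertex_list ->
  perm_eq (vertex_angles a (tset (unzip1 v))) [seq corner_angle x | x <- v].
Proof.
move=> hv; have [uv hx] := vertex_listP hv.
have -> : [seq corner_angle x | x <- v] =
          [seq a i (tset (unzip1 v)) | i <- [seq inord j | j <- unzip1 v]].
  rewrite -!map_comp; apply/eq_in_map => x xv /=.
  by rewrite /corner_angle (vertex_corner hv xv).
apply/perm_map/uniq_perm; rewrite ?enum_uniq //.
  rewrite map_inj_in_uniq // => i j /mapP[x /hx[x1 _ _] ->] /mapP[y /hx[y1 _ _] ->].
  by move/(congr1 val); rewrite /= !inordK.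
move=> j; rewrite mem_enum inE; apply/idP/mapP => [jv|[k /mapP[x xv ->] ->]].
  by exists (j : nat); rewrite ?inord_val.
by have [x1 _ _] := hx x xv; rewrite inordK // map_f.
Qed.
End CornerAngles.

Section VertexSums.
Variables (R : realType) (a : angle_assignment R).
Local Notation angle := (corner_angle a).

Lemma tile_anglesE i : (i < 12)%N ->
  tile_angles a (inord i) = [seq angle (i, k) | k <- iota 0 5].
Proof.
move=> hi; rewrite /tile_angles -val_enum_ord -map_comp; apply: eq_map => k /=.
by rewrite /corner_angle /= inord_val.
Qed.

Hypothesis vertex_sum : forall A, A \in vertices -> \sum_(i in A) a i A = 2 * pi.

Lemma corner_sum v : v \in vertex_list -> \sum_(x <- v) angle x = 2 * pi.
Proof.
move=> hv; rewrite -(vertex_sum (introT (verticesP _) (ex_intro2 _ _ v hv erefl))).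
set A := tset _; have -> : \sum_(i in A) a i A = \sum_(z <- vertex_angles a A) z.
  by rewrite /vertex_angles big_map big_enum.
by rewrite (perm_big _ (perm_vertex_angles a hv)) big_map.
Qed.

(** The 60 corners are counted twice: the 20 vertices give 40 pi, the 12 tiles give 12 S. *)
Lemma tile_sum S : (forall i, \sum_(z <- tile_angles a i) z = S) -> 3 * S = 10 * pi.
Proof.
move=> tileS.
have : \sum_(x <- flatten vertex_list) angle x = 40 * pi.
  rewrite big_flatten (eq_big_seq (fun=> 2 * pi)) => [|v /corner_sum //].
  rewrite big_const_seq iter_addr_0 (_ : count _ _ = 20)%N //; lra.
have /(perm_big _)-> : perm_eq (flatten vertex_list) all_corners by vm_compute.
have -> : all_corners = [seq (i, k) | i <- iota 0 12, k <- iota 0 5]%N by [].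
rewrite big_allpairs_dep (eq_big_seq (fun=> S)) => [|i].
  by rewrite big_const_seq iter_addr_0 (_ : count _ _ = 12)%N //; lra.
by rewrite mem_iota => hi; rewrite -(tileS (inord i)) tile_anglesE // big_map.
Qed.
End VertexSums.

(** * Congruences of tiles as dihedral words *)

(* If [s] lists the images of the five edges under a congruence of tiles, the
   [k]-th vertex is sent to the vertex number [vertex_image s k]: the image of edge k
   if orientation is preserved, and that of edge k+1 otherwise. *)
Definition vertex_image (s : seq nat) (k : nat) : nat :=
  let x := nth 0%N s k in let y := nth 0%N s (k.+1 %% 5) in
  if y == (x.+1 %% 5)%N then x else y.
(** The inverse is taken because the angle of the second tile at vertex [j] is that of the first
    tile at the preimage of [j]. *)
Definition inverse_word (s : seq nat) : seq nat :=
  let t := [seq vertex_image s k | k <- iota 0 5] in [seq index j t | j <- iota 0 5].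
Definition nat_adjacent (i j : nat) : bool := (j == i.+1 %% 5)%N || (i == j.+1 %% 5)%N.

(** The automorphisms of a 5-cycle form the dihedral group; all 120 permutations are tested. *)
Lemma inverse_word_dihedral s : perm_eq s (iota 0 5) ->
  all (fun k => nat_adjacent (nth 0%N s k) (nth 0%N s (k.+1 %% 5)%N)) (iota 0 5) ->
  inverse_word s \in words /\
  perm_eq [seq vertex_image s k | k <- iota 0 5] (iota 0 5).
Proof.
rewrite -mem_permutations => hs hadj.
have /allP/(_ s hs)/implyP/(_ hadj)/andP[] // : all (fun s =>
  all (fun k => nat_adjacent (nth 0 s k) (nth 0 s (k.+1 %% 5))) (iota 0 5) ==>
  ((inverse_word s \in words) &&
   perm_eq [seq vertex_image s k | k <- iota 0 5] (iota 0 5)))%N (permutations (iota 0 5)).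
by vm_compute.
Qed.

Lemma ordS_inord k : (k < 5)%N -> ordS (inord k) = inord (k.+1 %% 5) :> 'I_5.
Proof. by move=> hk; apply: val_inj; rewrite /= !inordK ?ltn_mod. Qed.

Section Congruence.
Variables (R : realType) (a : angle_assignment R).
Local Notation angle := (corner_angle a).

Lemma cornerC i (k l : 'I_5) : corner i k l = corner i l k.
Proof. by rewrite /corner setUAC. Qed.

Lemma congruent_word i j : angle_congruent a i j ->
  exists2 D, D \in words &
    tile_angles a j = [seq nth 0 (tile_angles a i) k | k <- D].
Proof.
move=> [f hf].
pose s := [seq val (f k) | k <- enum 'I_5].
have sE k (hk : (k < 5)%N) : nth 0%N s k = f (inord k).
  by rewrite (nth_map ord0) ?size_enum_ord // -[k in LHS](inordK hk) nth_ord_enum.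
have [] := @inverse_word_dihedral s.
- apply: uniq_perm; rewrite ?iota_uniq //.
    rewrite map_inj_uniq ?enum_uniq //; exact: inj_comp val_inj perm_inj.
  move=> k; rewrite mem_iota; apply/mapP/idP => [[l _ ->]|hk]; first exact: ltn_ord.
  by exists (f^-1%g (inord k)); rewrite ?mem_enum // permKV /= inordK.
- apply/allP => k; rewrite mem_iota => hk; rewrite !sE ?ltn_mod //.
  have [] := hf (inord k) (ordS (inord k)); first by rewrite /adjacent_edges eqxx.
  by rewrite /adjacent_edges -!val_eqE ordS_inord //= => h _.
set t := map _ _ => Dw tP.
have angE k (hk : (k < 5)%N) : angle (i : nat, k) = angle (j : nat, vertex_image s k).
  have [] := hf (inord k) (ordS (inord k)); first by rewrite /adjacent_edges eqxx.
  move=> fadj; rewrite /corner_angle /= !inord_val => ->.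
  rewrite /vertex_image !sE ?ltn_mod // -ordS_inord //.
  move: fadj; rewrite /adjacent_edges -val_eqE /= => fadj.
  (* Either [f] keeps the orientation at this corner, or the two image edges come in the opposite
     order and swapping them leaves the corner unchanged. *)
  case: ifP => [/eqP fE|nfE]; congr (a _ _).
    by rewrite inord_val /corner /vertex; congr (_ :|: [set nbr j _]); apply: val_inj.
  move: fadj; rewrite nfE /= => /eqP fE.
  by rewrite inord_val cornerC fE.
have tE : size t = 5%N by rewrite (perm_size tP).
exists (inverse_word s) => //.
rewrite -[i in RHS]inord_val -[j in LHS]inord_val !tile_anglesE //.
rewrite /inverse_word -map_comp; apply/eq_in_map => l; rewrite mem_iota => hl; rewrite [RHS]/comp.
have lt : l \in t by rewrite (perm_mem tP) mem_iota.
have hit : (index l t < 5)%N by rewrite -tE index_mem.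
rewrite (nth_map 0%N) ?size_iota // nth_iota // angE //; congr (angle (_, _)).
by have := nth_index 0%N lt; rewrite {1}/t (nth_map 0%N) ?size_iota // nth_iota.
Qed.
End Congruence.

(** * Dot and cross products in dimension three *)

Definition vmap (R : nzRingType) (u : vec int) : vec R :=
  let: (u1, u2, u3) := u in (u1%:~R, u2%:~R, u3%:~R).

Lemma vmap0 (R : nzRingType) : vmap R 0 = 0.
Proof. by []. Qed.

Lemma vmapD (R : nzRingType) u v : vmap R (u + v) = vmap R u + vmap R v.
Proof.
by case: u v => [[u1 u2] u3] [[v1 v2] v3]; rewrite /vmap /= !rmorphD.
Qed.

Lemma vdot_vmap (R : comNzRingType) u v : vdot (vmap R u) (vmap R v) = (vdot u v)%:~R.
Proof. by case: u v => [[u1 u2] u3] [[v1 v2] v3]; rewrite /= !(rmorphD, rmorphM). Qed.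

Lemma vcross_vmap (R : comNzRingType) u v :
  vcross (vmap R u) (vmap R v) = vmap R (vcross u v).
Proof. by case: u v => [[u1 u2] u3] [[v1 v2] v3]; rewrite /= !(rmorphB, rmorphM). Qed.

Lemma vmap_eq0 (R : numDomainType) u : (vmap R u == 0) = (u == 0).
Proof. by case: u => [[u1 u2] u3]; rewrite -!pair_eqE /= /pair_eq /= -!pair_eqE /= !intr_eq0. Qed.

Lemma vdotC (R : comNzRingType) (u v : vec R) : vdot u v = vdot v u.
Proof. case: u v => [[u1 u2] u3] [[v1 v2] v3] /=; ring. Qed.

Lemma vdotDl (R : comNzRingType) (u v w : vec R) : vdot (u + v) w = vdot u w + vdot v w.
Proof. case: u v w => [[u1 u2] u3] [[v1 v2] v3] [[w1 w2] w3] /=; ring. Qed.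

Lemma vdot0l (R : comNzRingType) (u : vec R) : vdot 0 u = 0.
Proof. case: u => [[u1 u2] u3] /=; ring. Qed.

(** Modulo the components of the cross product, each [u_i (m . v)] equals [v_i (m . u)], which is 0;
    some [u_i] is nonzero. *)
Lemma vdot_parallel (R : idomainType) (u v m : vec R) :
  vcross u v = 0 -> u != 0 -> vdot m u = 0 -> vdot m v = 0.
Proof.
case: u v m => [[u1 u2] u3] [[v1 v2] v3] [[m1 m2] m3] /= [e1 e2 e3] u0 mu.
have [z1 z2 z3] : [/\ u1 * (m1 * v1 + m2 * v2 + m3 * v3) = 0,
    u2 * (m1 * v1 + m2 * v2 + m3 * v3) = 0 & u3 * (m1 * v1 + m2 * v2 + m3 * v3) = 0].
  split.
  - transitivity (v1 * (m1 * u1 + m2 * u2 + m3 * u3) + m2 * (u1 * v2 - u2 * v1)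
      - m3 * (u3 * v1 - u1 * v3)); first by ring.
    by rewrite mu e2 e3; ring.
  - transitivity (v2 * (m1 * u1 + m2 * u2 + m3 * u3) - m1 * (u1 * v2 - u2 * v1)
      + m3 * (u2 * v3 - u3 * v2)); first by ring.
    by rewrite mu e1 e3; ring.
  - transitivity (v3 * (m1 * u1 + m2 * u2 + m3 * u3) + m1 * (u3 * v1 - u1 * v3)
      - m2 * (u2 * v3 - u3 * v2)); first by ring.
    by rewrite mu e1 e2; ring.
apply/eqP; apply: contraNT u0 => z.
move: z1 z2 z3 => /eqP + /eqP + /eqP.
by rewrite !mulf_eq0 (negPf z) !orbF => /eqP-> /eqP-> /eqP->.
Qed.

(** This is the triple product formula [(u x v) x w = (u . w) v - (v . w) u], with [x] as [w]. *)
Lemma vcross_orthogonal (R : comNzRingType) (u v x : vec R) :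
  vdot u x = 0 -> vdot v x = 0 -> vcross (vcross u v) x = 0.
Proof.
case: u v x => [[u1 u2] u3] [[v1 v2] v3] [[x1 x2] x3] /= e e'.
congr (_, _, _).
- transitivity (v1 * (u1 * x1 + u2 * x2 + u3 * x3) - u1 * (v1 * x1 + v2 * x2 + v3 * x3)).
    by ring.
  by rewrite e e'; ring.
- transitivity (v2 * (u1 * x1 + u2 * x2 + u3 * x3) - u2 * (v1 * x1 + v2 * x2 + v3 * x3)).
    by ring.
  by rewrite e e'; ring.
- transitivity (v3 * (u1 * x1 + u2 * x2 + u3 * x3) - u3 * (v1 * x1 + v2 * x2 + v3 * x3)).
    by ring.
  by rewrite e e'; ring.
Qed.

Lemma vcrossC (R : comNzRingType) (u v : vec R) : vcross u v = 0 -> vcross v u = 0.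
Proof.
case: u v => [[u1 u2] u3] [[v1 v2] v3] /= [/eqP + /eqP + /eqP].
rewrite !subr_eq0 => /eqP e1 /eqP e2 /eqP e3.
by rewrite !(mulrC v1, mulrC v2, mulrC v3) e1 e2 e3 !subrr.
Qed.

(** * Soundness of the search *)

Section SearchSoundness.
Variables (R : numDomainType) (x : vec R).
Hypothesis x_generic : forall m, m \in nonzero -> vdot (vmap R m) x != 0.

Definition holds (K : info) : Prop :=
  match K with
  | Orth l => vdot (vmap R l) x = 0
  | Dir q => q != 0 /\ vcross (vmap R q) x = 0
  end.

Let x_neq0 : x != 0.
Proof.
apply/eqP => x0; have := x_generic (mem_head _ _).
by rewrite x0 vdotC vdot0l eqxx.
Qed.

Lemma update_sound l K : vdot (vmap R l) x = 0 -> holds K ->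
  exists2 K', update l K = Some K' & holds K'.
Proof.
move=> lx; case: K => [l'|q]; rewrite /update /holds => Kx.
  case: eqVneq => [l'0|l'0].
    case: eqVneq => [l0|l0]; first by exists (Orth l').
    rewrite anyE; case: hasP => [[m mn /eqP ml]|_]; last by exists (Orth l).
    have := x_generic mn; rewrite vdotC (@vdot_parallel _ (vmap R l)) ?eqxx ?vmap_eq0 //.
      by rewrite vcross_vmap ml.
    by rewrite vdotC.
  case: eqVneq => [_|q0]; first by exists (Orth l').
  have qx : vcross (vmap R (vcross l' l)) x = 0.
    by rewrite -vcross_vmap vcross_orthogonal.
  rewrite anyE; case: hasP => [[m mn /eqP mq]|_]; last by exists (Dir (vcross l' l)).
  have := x_generic mn; rewrite (vdot_parallel qx) ?eqxx ?vmap_eq0 //.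
  by rewrite vdot_vmap mq.
(* The roles are exchanged: [x] is the nonzero vector, and [l] is orthogonal to it, hence to the
   parallel vector [q]. *)
case: Kx => q0 qx; have : vdot (vmap R l) (vmap R q) = 0.
  exact: vdot_parallel (vcrossC qx) x_neq0 lx.
by rewrite vdot_vmap => /eqP; rewrite intr_eq0 => ->; exists (Dir q).
Qed.

Definition vertex_closed (c : config) (v : seq (nat * nat)) : Prop :=
  vdot (vmap R (vdev c v)) x = 0.

Lemma refine_sound c vs K : (forall v, v \in vs -> vertex_closed c v) -> holds K ->
  exists2 K', refine c vs K = Some K' & holds K'.
Proof.
elim: vs K => [|v vs IH] K vsx Kx /=; first by exists K.
have [K' -> K'x] := update_sound (vsx v (mem_head _ _)) Kx.
by apply: IH => // w hw; apply: vsx; rewrite inE hw orbT.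
Qed.

Lemma searchS leaf m c K : search leaf m.+1 c K =
  all (fun w => if refine (rcons c w) (nth [::] completed (size c)) K is Some K'
                then search leaf m (rcons c w) K' else true) words.
Proof. by []. Qed.

Lemma search_sound leaf m c d K : size (c ++ d) = 12%N -> size d = m ->
  {subset d <= words} -> (forall v, v \in vertex_list -> vertex_closed (c ++ d) v) ->
  holds K -> search leaf m c K -> leaf (c ++ d).
Proof.
elim: m c d K => [|m IH] c [|w d] K // cd12.
  by rewrite cats0.
move=> [dm] dw closed Kx; rewrite searchS => /allP /(_ w (dw w (mem_head _ _))).
have cdE : rcons c w ++ d = c ++ w :: d by rewrite cat_rcons.
have c_lt : (size c < 12)%N by rewrite -cd12 size_cat /= -addSnnS leq_addr.
(* These vertices involve only tiles that already have a word, so the later words [d] do not change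
   their deviation vectors. *)
have prefix_closed v : v \in nth [::] completed (size c) -> vertex_closed (rcons c w) v.
  move=> hv.
  have /allP/(_ (size c)) : all (fun n => all (fun v => (v \in vertex_list) &&
     all (fun y => y.1 <= n) v) (nth [::] completed n))%N (iota 0 12) by vm_compute.
  rewrite mem_iota c_lt => /(_ isT) /allP/(_ v hv) /andP[/closed + /allP v_le].
  rewrite /vertex_closed /vdev -cdE
    (_ : map _ _ = [seq nth 0 dev (code (rcons c w) y) | y <- v]) //.
  apply/eq_in_map => y /v_le y_le; congr (nth _ _ _).
  by rewrite /code nth_cat size_rcons ltnS y_le.
have [K' -> K'x] := refine_sound prefix_closed Kx.
rewrite -cdE; apply: IH => //; rewrite ?cdE //.
by move=> u ud; apply: dw; rewrite inE ud orbT.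
Qed.
End SearchSoundness.

(** * From tables of images to symmetries of the pattern *)

Lemma symmetriesP p : p \in symmetries ->
  [/\ uniq p, size p = 12%N, all (gtn 12) p &
   forall i k, (i < 12)%N -> (k < 5)%N -> let y := image_corner p (i, k) in
     [/\ (y.1 < 12)%N, (y.2 < 5)%N,
         perm_eq (vx y.1 y.2) [seq nth 0%N p l | l <- vx i k] &
         exists2 k', (k' < 5)%N & nb (nth 0%N p i) k' = nth 0%N p (nb i k)]].
Proof.
have /allP : all (fun p => [&& uniq p, size p == 12, all (gtn 12) p &
  all (fun x => let y := image_corner p x in
    [&& y.1 < 12, y.2 < 5, perm_eq (vx y.1 y.2) [seq nth 0 p l | l <- vx x.1 x.2] &
     has (fun k' => nb (nth 0 p x.1) k' == nth 0 p (nb x.1 x.2)) (iota 0 5)])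
    all_corners])%N symmetries by vm_compute.
move=> h /h /and4P[up /eqP sp ltp /allP hp]; split=> // i k hi hk /=.
have /and4P[y1 y2 yv /hasP[k']] := hp _ (mem_all_corners hi hk).
by rewrite mem_iota => hk' /eqP kE; split => //; exists k'.
Qed.

(** Taking images under [s] is injective, so it maps the finite family [S] onto itself, which gives
    the converse implication. *)
Lemma imset_stable (T : finType) (s : {perm T}) (S : {set {set T}}) :
  (forall A : {set T}, A \in S -> s @: A \in S) ->
  forall A : {set T}, (s @: A \in S) = (A \in S).
Proof.
move=> sS A; have s_inj : injective (fun A : {set T} => s @: A) by apply/imset_inj/perm_inj.
have SE : [set s @: A | A : {set T} in S] = S.
  apply/eqP; rewrite eqEcard card_imset // leqnn andbT.
  by apply/subsetP => _ /imsetP[B BS ->]; apply: sS.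
by rewrite -[in LHS]SE (mem_imset _ _ s_inj).
Qed.

Lemma symmetry_of_table p : p \in symmetries ->
  exists2 s : {perm tile}, symmetry s &
    forall (R : realType) (a : angle_assignment R) (i : tile) (k : 'I_5),
      a (s i) (s @: vertex i k) = corner_angle a (image_corner p (i : nat, k : nat)).
Proof.
move=> /symmetriesP[up sp /allP ltp hp].
have p_lt i : (i < 12)%N -> (nth 0%N p i < 12)%N.
  by move=> hi; apply: ltp; rewrite mem_nth ?sp.
have f_inj : injective (fun i : tile => inord (nth 0%N p i) : tile).
  move=> i j /(congr1 val); rewrite /= !inordK ?p_lt // => /eqP.
  by rewrite nth_uniq ?sp // => /eqP/val_inj.
pose s := perm f_inj.
have sE i : s i = nth 0%N p i :> nat by rewrite permE inordK ?p_lt.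
have s_tset l : all (gtn 12) l -> s @: tset l = tset [seq nth 0%N p j | j <- l].
  move=> /allP l_lt; apply/setP => j; rewrite inE.
  apply/imsetP/mapP => [[i + ->]|[i il ij]].
    by rewrite inE => il; exists (i : nat); rewrite ?sE.
  have i_lt := l_lt i il; exists (inord i); first by rewrite inE inordK.
  by apply: val_inj; rewrite /= sE inordK.
have s_vertex (i : tile) (k : 'I_5) : s @: vertex i k =
    vertex (inord (image_corner p (i : nat, k : nat)).1)
           (inord (image_corner p (i : nat, k : nat)).2).
  have [y1 y2 yv _] := hp i k (ltn_ord i) (ltn_ord k).
  rewrite !vertexE s_tset ?(eq_tset yv) //= ?inordK ?(eq_tset yv) //.
  by rewrite ltn_ord !nb_lt ?ltn_mod.
exists s.
  split; apply: imset_stable => A /imset2P[i k _ _ ->].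
    have [_ _ _ [k' hk' kE]] := hp i k (ltn_ord i) (ltn_ord k).
    apply/imset2P; exists (s i) (inord k') => //.
    by rewrite !edgeE s_tset /= ?sE ?inordK ?kE // ltn_ord nb_lt.
  by rewrite s_vertex; apply/imset2P; eexists; eexists.
move=> R a i k; rewrite s_vertex /corner_angle; congr (a _ _).
by apply: val_inj; rewrite /= sE inordK ?p_lt.
Qed.

(** * From codes back to angles *)

Lemma words_lt5 w z : w \in words -> z \in w -> (z < 5)%N.
Proof.
have /allP h : all (all (gtn 5)) words by vm_compute.
by move=> /h /allP; apply.
Qed.

Lemma classifiedP c : classified c -> exists W p r,
  [/\ W \in tilings, p \in symmetries,
     [/\ perm_eq r (iota 0 5), head 1%N r = 0%N & has_combination c r] &
     forall i k, (i < 12)%N -> (k < 5)%N ->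
       code c (image_corner p (i, k)) = nth 0%N r (code W (i, k))].
Proof.
rewrite /classified anyE => /hasP[W hW]; rewrite anyE => /hasP[p hp].
case: ifP => //; rewrite /same_pattern; case: ifP => // /eqP r0; rewrite everyE => /allP cW.
move=> /andP[rP comb]; exists W, p, (renaming c W p); split=> // i k hi hk.
exact/eqP/(cW _ (mem_all_corners hi hk)).
Qed.

Section Decode.
Variables (R : realType) (a : angle_assignment R) (u : seq R) (c : config).
Hypotheses (u_uniq : uniq u) (u_size : size u = 5%N).
Hypothesis c_lt : forall x, (code c x < 5)%N.
Hypothesis c_angle : forall i k, (i < 12)%N -> (k < 5)%N ->
  corner_angle a (i, k) = nth 0 u (code c (i, k)).

(** As [u] has no repetition, [index] inverts the decoding of codes below 5. *)
Lemma perm_decode s t : all (gtn 5) s -> all (gtn 5) t ->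
  perm_eq [seq nth 0 u z | z <- s] [seq nth 0 u z | z <- t] = perm_eq s t.
Proof.
move=> /allP hs /allP ht; apply/idP/idP; last exact: perm_map.
move=> /(perm_map (index^~ u)); rewrite -!map_comp.
by rewrite !map_id_in // => z /= => [/ht|/hs] zlt; rewrite index_uniq ?u_size.
Qed.

Lemma perm_vertex_codes v t : v \in vertex_list -> all (gtn 5) t ->
  perm_eq (vertex_angles a (tset (unzip1 v))) [seq nth 0 u z | z <- t] =
  perm_eq t [seq code c x | x <- v].
Proof.
move=> hv ht; have [_ v_lt] := vertex_listP hv.
rewrite (permPl (perm_vertex_angles a hv)).
have -> : [seq corner_angle a x | x <- v] = [seq nth 0 u z | z <- [seq code c x | x <- v]].
  rewrite -map_comp; apply/eq_in_map => -[i k] /v_lt[hi hk _] /=; exact: c_angle.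
by rewrite perm_decode 1?perm_sym //; apply/allP => _ /mapP[x _ ->]; apply: c_lt.
Qed.

Lemma combination_decode r : all (gtn 5) r -> has_combination c r ->
  anglewise_vertex_combination a
    [seq (mt.1, [seq nth 0 u z | z <- mt.2]) | mt <- combination r].
Proof.
(* Past the end of [r] the default 0 is still a valid code. *)
move=> /allP r_lt; have z_lt i : (nth 0%N r i < 5)%N.
  by have [/(mem_nth 0%N)/r_lt|/(nth_default 0%N) ->] := ltnP i (size r).
have t_lt mt : mt \in combination r -> all (gtn 5) mt.2.
  by apply/allP: mt; rewrite /= !z_lt.
move=> /andP[/allP cnt /allP cover]; split=> [_ /mapP[mt hmt ->]|A /verticesP[v hv ->]].
  rewrite /= card_vertices -(eqP (cnt _ hmt)) count_map.
  by apply: eq_in_count => v hv /=; rewrite perm_vertex_codes ?t_lt.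
have /hasP[mt hmt vmt] := cover _ (map_f _ hv).
exists (mt.1, [seq nth 0 u z | z <- mt.2]); first by apply/mapP; exists mt.
by rewrite perm_vertex_codes ?t_lt.
Qed.
End Decode.

(** * Deviations of the actual angles from [al] *)

Definition deviation (R : realType) (al b c d : R) : vec R := (b - al, c - al, d - al).

Lemma vdot_deviation (R : realType) (al b c d : R) (m1 m2 m3 : int) :
  vdot (vmap R (m1, m2, m3)) (deviation al b c d) =
    (m1%:~R * (b - al) + m2%:~R * (c - al) + m3%:~R * (d - al) : R).
Proof. by []. Qed.

(** By the condition on the sum, [e - al] is minus the sum of the three coordinates, so each form of
    [nonzero] evaluates to a difference of two of the five angles, up to sign. *)
Lemma deviation_generic (R : realType) (al b c d e : R) m :
  uniq [:: al; b; c; d; e] -> al + b + c + d + e = 5 * al ->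
  m \in nonzero -> vdot (vmap R m) (deviation al b c d) != 0.
Proof.
move=> distinct mean.
suff /allP h : all (fun m => vdot (vmap R m) (deviation al b c d) != 0 :> R) nonzero by exact: h.
rewrite /nonzero /all !vdot_deviation !(mulr0z, mulr1z, mulrN1z, mulrz_nat).
move: distinct; rewrite /= !inE !negb_or !andbT.
move=> /and4P[/and4P[n1 n2 n3 n4] /and3P[n5 n6 n7] /andP[n8 n9] n10].
apply/and5P; split; last (apply/and5P; split; last apply/andP; last split).
- by apply: contra_neq n1 => h; lra.
- by apply: contra_neq n2 => h; lra.
- by apply: contra_neq n3 => h; lra.
- by apply: contra_neq n4 => h; lra.
- by apply: contra_neq n5 => h; lra.
- by apply: contra_neq n6 => h; lra.
- by apply: contra_neq n8 => h; lra.
- by apply: contra_neq n7 => h; lra.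
- by apply: contra_neq n9 => h; lra.
- by apply: contra_neq n10 => h; lra.
Qed.

Lemma vdot_dev (R : realType) (al b c d e : R) z :
  al + b + c + d + e = 5 * al -> (z < 5)%N ->
  vdot (vmap R (nth 0 dev z)) (deviation al b c d) =
    (nth 0 [:: al; b; c; d; e] z - al : R).
Proof.
move=> mean; case: z => [|[|[|[|[|]]]]] // _.
all: rewrite [nth _ _ _]/= [in RHS]/= vdot_deviation ?(mulr0z, mulr1z, mulrN1z); lra.
Qed.

Lemma vdot_vdev (R : realType) (al b c d e : R) cf v :
  al + b + c + d + e = 5 * al -> (forall y, (code cf y < 5)%N) ->
  vdot (vmap R (vdev cf v)) (deviation al b c d) =
    (\sum_(y <- v) (nth 0 [:: al; b; c; d; e] (code cf y) - al) : R).
Proof.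
move=> mean cf_lt; rewrite /vdev; elim: v => [|y v IH].
  by rewrite big_nil [foldr _ _ _]/= vmap0 vdot0l.
by rewrite map_cons big_cons [foldr _ _ _]/= vmapD vdotDl IH (vdot_dev mean).
Qed.

(** Letters are numbered along the first tile starting from [al], so this tile carries a rotation of
    0 1 2 3 4; which one depends on the place of [al]. [Orth 0] is the absence of information. *)
Lemma search_rotations :
  all (fun w => search classified 11 [:: w] (Orth 0)) rotations.
Proof. by vm_compute. Qed.

(** * Encoding a tiling as a configuration *)

(** [u] is [t] read cyclically from [x], and [E] is the rotation that undoes this. *)
Lemma word_rotation (T : eqType) (x0 x : T) (t : seq T) : size t = 5%N -> x \in t ->
  exists u E, [/\ head x0 u = x, perm_eq u t, E \in rotations
    & t = [seq nth x0 u z | z <- E]].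
Proof.
move=> t5 xt; pose n := index x t; have n5 : (n < 5)%N by rewrite -t5 index_mem.
exists (rot n t), (rotr n (iota 0 5)); split.
- by rewrite /n rot_index.
- by rewrite perm_rot.
- by move: n n5 => [|[|[|[|[|]]]]].
- have := mkseq_nth x0 (rot n t).
  by rewrite /mkseq size_rot t5 map_rotr => ->; rewrite rotK.
Qed.

Lemma word_compose E D : E \in rotations -> D \in words ->
  [seq nth 0%N E z | z <- D] \in words.
Proof.
move=> hE hD; have /allP/(_ E hE)/allP/(_ D hD) // : all (fun E =>
  all (fun D => [seq nth 0%N E z | z <- D] \in words) words) rotations.
by vm_compute.
Qed.

Lemma config_of_tiling (R : realType) (a : angle_assignment R) (al : R) :
  al \in tile_angles a 0 -> (forall i, angle_congruent a 0 i) -> uniq (tile_angles a 0) ->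
  exists u c,
    [/\ head 0 u = al, perm_eq u (tile_angles a 0), size c = 12%N
      & [/\ nth [::] c 0 \in rotations, {subset c <= words} &
     forall i k, (i < 12)%N -> (k < 5)%N ->
       corner_angle a (i, k) = nth 0 u (code c (i, k))]].
Proof.
move=> al0 cong t_uniq.
have t5 : size (tile_angles a 0) = 5%N by rewrite size_map size_enum_ord.
have [u [E [u0 ut hE tE]]] := word_rotation 0 t5 al0.
have u_uniq : uniq u by rewrite (perm_uniq ut).
have u5 : size u = 5%N by rewrite (perm_size ut).
have E_lt z : z \in E -> (z < 5)%N.
  by apply: words_lt5; rewrite (_ : words = rotations ++ map rev rotations) // mem_cat hE.
have indexK F : {in F, forall z, z < 5}%N ->
    [seq index y u | y <- [seq nth 0 u z | z <- F]] = F.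
  by move=> F_lt; rewrite -map_comp map_id_in // => z /F_lt z5 /=; rewrite index_uniq ?u5.
pose w i := [seq index y u | y <- tile_angles a (inord i)].
have wP i : w i \in words /\ tile_angles a (inord i) = [seq nth 0 u z | z <- w i].
  have [D hD DE] := congruent_word (cong (inord i)).
  (* Tile [i] reads the first tile through [D], and the first tile reads [u] through [E]. *)
  have {}DE : tile_angles a (inord i) = [seq nth 0 u z | z <- [seq nth 0%N E z | z <- D]].
    rewrite DE {1}tE -map_comp; apply/eq_in_map => z /(words_lt5 hD) z5 /=.
    rewrite (nth_map 0%N) // (_ : size E = 5%N) //.
    by rewrite -t5 tE size_map.
  have F_words := word_compose hE hD.
  by rewrite /w DE indexK // => z; apply: words_lt5.
exists u, [seq w i | i <- iota 0 12]; split=> //.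
have cE i : (i < 12)%N -> nth [::] [seq w i | i <- iota 0 12] i = w i.
  by move=> hi; rewrite (nth_map 0%N) ?size_iota // nth_iota.
split.
- rewrite cE // /w (_ : inord 0 = 0) ?[in X in index _ u X]tE; last exact/val_inj/inordK.
  by rewrite tE indexK.
- by move=> _ /mapP[i _ ->]; case: (wP i).
move=> i k hi hk; have [wi iE] := wP i.
rewrite /code cE //= -(nth_map _ 0) -?iE.
  by rewrite tile_anglesE // (nth_map 0%N) ?size_iota // nth_iota.
by move: iE; rewrite tile_anglesE // => /(congr1 size); rewrite !size_map size_iota => <-.
Qed.

(** * The classification *)

Theorem proposition20 (R : realType) (a : angle_assignment R)
    (al be ga de ep : R)
    (Ha : angle_congruent_tiling a)
    (Hangles : forall i : tile,
       perm_eq (tile_angles a i) [:: al; be; ga; de; ep])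
    (Hal : al = 2 * pi / 3)
    (Hdistinct : uniq [:: al; be; ga; de; ep]) :
  exists be' ga' de' ep' : R,
    perm_eq [:: be; ga; de; ep] [:: be'; ga'; de'; ep'] /\
    anglewise_vertex_combination a
      [:: (2%N, [:: al; al; al]); (6%N, [:: al; ga'; ep']);
          (6%N, [:: be'; be'; ga']); (6%N, [:: de'; de'; ep'])] /\
    exists2 s : {perm tile}, symmetry s &
      given_by a s (tiling_i al be' ga' de' ep') \/
      given_by a s (tiling_ii al be' ga' de' ep') \/
      given_by a s (tiling_iii al be' ga' de' ep') \/
      given_by a s (tiling_iv al be' ga' de' ep').
Proof.
case: Ha => vsum cong.
have t_uniq : uniq (tile_angles a 0) by rewrite (perm_uniq (Hangles 0)).
have al0 : al \in tile_angles a 0 by rewrite (perm_mem (Hangles 0)) mem_head.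
have [u [c [u0 ut c12 [c0 c_words c_angle]]]] := config_of_tiling al0 (cong 0) t_uniq.
have u_perm : perm_eq u [:: al; be; ga; de; ep] := perm_trans ut (Hangles 0).
have u_uniq : uniq u by rewrite (perm_uniq u_perm).
have u5 : size u = 5%N by rewrite (perm_size u_perm).
have c_lt x : (code c x < 5)%N.
  rewrite /code; set row := nth [::] c x.1.
  have [x1|x1] := ltnP x.1 (size c); last by rewrite /row (nth_default [::]) ?nth_nil.
  have [x2|x2] := ltnP x.2 (size row); last by rewrite nth_default.
  by apply: (@words_lt5 row); rewrite ?c_words // mem_nth.
have [b [g [d [e uE]]]] : exists b g d e, u = [:: al; b; g; d; e].
  case: u u5 u0 {u_perm u_uniq ut c_angle} => [|x [|b [|g [|d [|e []]]]]] //= _ ->.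
  by exists b, g, d, e.
(* The angle sum of a tile is 10 pi / 3, five times [al]. *)
have mean : al + b + g + d + e = 5 * al.
  have : 3 * (\sum_(z <- u) z) = 10 * pi.
    apply: (tile_sum vsum) => i; apply: perm_big.
    by rewrite (permPl (Hangles i)) perm_sym.
  rewrite uE !big_cons big_nil Hal; lra.
have cE : c = [:: nth [::] c 0] ++ behead c by case: (c) c12.
have c_classified : classified c.
  rewrite cE; apply: (@search_sound R (deviation al b g d) _ _ 11 _ _ (Orth 0)).
  - by move=> m; apply: deviation_generic mean; rewrite -uE.
  - by rewrite -cE.
  - by rewrite size_behead c12.
  - by move=> w /mem_behead /c_words.
  - move=> v hv; rewrite -cE /vertex_closed (vdot_vdev _ mean) // -uE.
    have [_ v_lt] := vertex_listP hv.
    (* Three angles with sum 2 pi have deviations from 2 pi / 3 with sum zero. *)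
    rewrite sumrB (_ : \sum_(y <- v) _ = \sum_(y <- v) corner_angle a y); last first.
      by apply: eq_big_seq => -[i k] /v_lt[hi hk _]; rewrite c_angle.
    have v3 : size v = 3%N.
      by apply/eqP; move: v hv {v_lt}; apply/allP; vm_compute.
    rewrite (corner_sum vsum hv) big_const_seq count_predT v3 /= Hal; lra.
  - by rewrite /holds vmap0 vdot0l.
  - exact: (allP search_rotations).
have [W [p [r [hW hp [r_perm r0 r_comb] cW]]]] := classifiedP c_classified.
have [s s_sym sE] := symmetry_of_table hp.
have r_lt : all (gtn 5) r.
  by apply/allP => z; rewrite (perm_mem r_perm) mem_iota.
have ur_perm : perm_eq u [seq nth 0 u z | z <- r].
  by have := mkseq_nth 0 u; rewrite /mkseq (permPr (perm_map _ r_perm)) u5 => ->.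
have comb := combination_decode u_uniq u5 c_lt c_angle r_lt r_comb.
have s_given (i : tile) (k : 'I_5) :
    a (s i) (s @: vertex i k) = nth 0 u (nth 0%N r (code W (i : nat, k : nat))).
  have [_ _ _ hpi] := symmetriesP hp.
  have [y1 y2 _ _] := hpi i k (ltn_ord i) (ltn_ord k).
  by rewrite sE -cW // -c_angle //; case: (image_corner _ _) y1 y2.
have r5 : size r = 5%N := perm_size r_perm.
case: r r5 r0 ur_perm comb s_given {r_perm r_lt r_comb cW} =>
  [|_ [|r1 [|r2 [|r3 [|r4 []]]]]] //= _ -> ur_perm comb s_given.
have al_u : nth 0 u 0 = al by rewrite nth0.
(* The renamed angle of letter [i] is the entry of [u] at the code that [r] gives to [i]; letter 0
   remains [al]. *)
exists (nth 0 u r1), (nth 0 u r2), (nth 0 u r3), (nth 0 u r4); split; last split.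
- by rewrite -(perm_cons al) -(permPl u_perm) -{1}al_u.
- by rewrite /combination /= al_u in comb.
exists s => //.
set ws := [:: al; nth 0 u r1; nth 0 u r2; nth 0 u r3; nth 0 u r4].
suff : given_by a s [seq [seq nth 0 ws z | z <- row] | row <- W].
  by move: hW; rewrite !inE => /or4P[] /eqP->; auto.
move=> i k; rewrite s_given.
have [W12 W5] : size W = 12%N /\ forall row, row \in W -> size row = 5%N.
  have /allP/(_ W hW) /andP[/eqP W12 /allP W5] : all (fun W => (size W == 12)%N &&
    all (fun row => size row == 5)%N W) tilings by vm_compute.
  by split=> // row /W5/eqP.
rewrite /code (nth_map [::]) ?W12 // (nth_map 0%N) ?W5 ?mem_nth ?W12 //=.
(* A letter below 5 leaves five cases, in each of which both sides agree by computation. *)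
have : (nth 0%N (nth [::] W i) k < 5)%N.
  have /allP/(_ W hW)/allP h : all (all (all (gtn 5))) tilings by vm_compute.
  by apply: (allP (h (nth [::] W i) _)); rewrite mem_nth ?W12 ?W5 ?mem_nth ?W12.
by case: (nth 0%N _ _) => [|[|[|[|[|]]]]].
Qed.
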